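(* Let $\{\pi^k\}_{k\ge 0}$ be generated by projected policy gradient (PPG) with any constant step size $\eta_k=\eta>0$ from an initial policy $\pi^0$. Then for all $k\ge 0$, $$V^*(\rho)-V^k(\rho)\le \left(1-(1-\gamma)\left\|\frac{d_\rho^*}{\rho}\right\|_\infty^{-1}\cdot\frac{(1-\gamma)C_2(\eta)}{(1-\gamma)C_2(\eta)+C_1(\eta)}\right)^k\left(V^*(\rho)-V^0(\rho)\right),$$ where $C_1(\eta):=\frac{2+5|\mathcal{A}|}{\eta\,\tilde\mu}$ and $C_2(\eta):=\frac{\tilde\rho\,\Delta}{2}\cdot\frac{\eta\,\tilde\mu\,\Delta}{1+\eta\,\tilde\mu\,\Delta}$.
   Context: MDP: a tuple $(\mathcal{S},\mathcal{A},P,r,\gamma)$ with finite state space $\mathcal{S}$, finite action space $\mathcal{A}$, transition probabilities $P(s'|s,a)$, reward $r:\mathcal{S}\times\mathcal{A}\to[0,1]$ and discount factor $\gamma\in[0,1)$. $\Delta(\mathcal{A})$, $\Delta(\mathcal{S})$ denote probability simplices; a policy is $\pi=(\pi(\cdot|s))_{s\in\mathcal{S}}$ with $\pi(\cdot|s)\in\Delta(\mathcal{A})$; $\pi_s$ denotes $\pi(\cdot|s)$. Values: $V^\pi(s)=\mathbb{E}[\sum_{t\ge0}\gamma^t r(s_t,a_t)\mid s_0=s,\pi]$, $Q^\pi(s,a)=\mathbb{E}[\sum_{t\ge0}\gamma^t r(s_t,a_t)\mid s_0=s,a_0=a,\pi]$, and $V^\pi(\rho)=\mathbb{E}_{s\sim\rho}[V^\pi(s)]$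 for $\rho\in\Delta(\mathcal{S})$. $V^*,Q^*$ are the optimal values, $A^*(s,a)=Q^*(s,a)-V^*(s)$, and an optimal policy is a policy whose state value is $V^*$. Visitation measure: $d_\rho^\pi(s)=(1-\gamma)\mathbb{E}[\sum_{t\ge0}\gamma^t\mathbf{1}\{s_t=s\}\mid s_0\sim\rho,\pi]$; $d_\rho^*=d_\rho^{\pi^*}$ for a fixed optimal policy $\pi^*$. For policies $\pi^k$, write $V^k,Q^k,d_\mu^k$ for $V^{\pi^k},Q^{\pi^k},d_\mu^{\pi^k}$. Ratios of vectors are entrywise, $\|\cdot\|_\infty$ is the maximum absolute entry. Optimal advantage gap: $\mathcal{A}_s^*=\arg\max_a A^*(s,a)$, $\tilde{\mathcal S}=\{s:\mathcal{A}_s^*\ne\mathcal{A}\}$ (assumed nonempty, so that the gap is defined), $\Delta=\min_{s\in\tilde{\mathcal S},\,a\notin\mathcal{A}_s^*}|A^*(s,a)|$. Distributions: $\mu\in\Delta(\mathcal{S})$ is fixed with $\tilde\mu=\min_s\mu(s)>0$; $\rho\in\Delta(\mathcal{S})$ is arbitrary with $\tilde\rho=\min_s\rho(s)>0$. PPG update: for every $s$, $\pi_s^{k+1}=\mathrm{Proj}_{\Delta(\mathcal{A})}\left(\pi_s^k+\eta_s^kQ^k(s,\cdot)\right)$ with $\eta_s^k=\frac{\eta_k}{1-\gamma}d_\mu^k(s)$, where $\mathrm{Proj}_{\Delta(\mathcal{A})}$ is the Euclidean projection onto the simplex. *)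

(* Defs.v *)
From HB Require Import structures.
From mathcomp Require Import all_boot all_order all_algebra.
From mathcomp Require Import all_classical all_reals all_analysis.

Set Implicit Arguments.
Unset Strict Implicit.
Unset Printing Implicit Defensive.

Import Order.TTheory GRing.Theory Num.Theory.
Import numFieldNormedType.Exports.

Local Open Scope classical_set_scope.
Local Open Scope ring_scope.

Section FiniteVectors.
Context {R : realType}.

Definition simplex (I : finType) : set (I -> R) :=
  [set p | (forall i, 0 <= p i) /\ \sum_i p i = 1].

Definition euclid_dist (I : finType) (u v : I -> R) : R :=
  Num.sqrt (\sum_i (u i - v i) ^+ 2).

Definition is_simplex_proj (I : finType) (v p : I -> R) : Prop :=
  simplex p /\ forall q, simplex q -> euclid_dist p v <= euclid_dist q v.

(* The junk value 0 of [\big[Num.max/0]] is harmless: all terms are >= 0. *)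
Definition norm_infty (I : finType) (v : I -> R) : R :=
  \big[Num.max/0]_i `|v i|.

(* Used only on nonempty finite [D], where the infimum is attained. *)
Definition min_over (I : Type) (D : set I) (f : I -> R) : R := inf (f @` D).

End FiniteVectors.

Record mdp (R : realType) (S A : finType) := MDP {
  trans : S -> A -> S -> R;
  reward : S -> A -> R;
  discount : R;
  trans_simplex : forall s a, simplex (trans s a);
  reward_bounded : forall s a, 0 <= reward s a <= 1;
  discount_bounded : 0 <= discount < 1 }.

Section MDP.
Context {R : realType} {S A : finType} (M : mdp R S A).

Local Notation gamma := (discount M).

Definition is_policy : set (S -> A -> R) :=
  [set pi | forall s, simplex (pi s)].

(* Probability of the trajectory tau = (s_0,a_0), ..., (s_n,a_n) when
   (s_0,a_0) has law x0 and actions are then chosen by pi. *)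
Definition traj_prob (pi : S -> A -> R) (x0 : S * A -> R) (n : nat)
    (tau : {ffun 'I_n.+1 -> S * A}) : R :=
  x0 (tau ord0) *
  \prod_(t < n)
    let x := tau (widen_ord (leqnSn n) t) in
    let y := tau (lift ord0 t) in
    trans M x.1 x.2 y.1 * pi y.1 y.2.

(* E[sum_(t >= 0) gamma^t f(s_t,a_t)], as the limit of the expectations of the
   sums truncated at horizon n, each taken over finite trajectories. *)
Definition disc_expect (pi : S -> A -> R) (x0 : S * A -> R)
    (f : S * A -> R) : R :=
  limn (fun n => \sum_(tau : {ffun 'I_n.+1 -> S * A})
    traj_prob pi x0 tau * \sum_(t < n.+1) gamma ^+ t * f (tau t)).

(* Law of (s_0,a_0) when s_0 ~ nu and a_0 ~ pi(.|s_0). *)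
Definition start (nu : S -> R) (pi : S -> A -> R) (x : S * A) : R :=
  nu x.1 * pi x.1 x.2.

Definition Vpi (pi : S -> A -> R) (s : S) : R :=
  disc_expect pi (start (fun s' => (s' == s)%:R) pi)
    (fun x => reward M x.1 x.2).

Definition Qpi (pi : S -> A -> R) (s : S) (a : A) : R :=
  disc_expect pi (fun x => (x == (s, a))%:R) (fun x => reward M x.1 x.2).

Definition visitation (nu : S -> R) (pi : S -> A -> R) (s : S) : R :=
  (1 - gamma) * disc_expect pi (start nu pi) (fun x => (x.1 == s)%:R).

Definition Vstar (s : S) : R := sup [set Vpi pi s | pi in is_policy].

Definition Qstar (s : S) (a : A) : R := sup [set Qpi pi s a | pi in is_policy].

Definition Astar (s : S) (a : A) : R := Qstar s a - Vstar s.

Definition is_optimal_policy (pi : S -> A -> R) : Prop :=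
  is_policy pi /\ forall s, Vpi pi s = Vstar s.

(* V(rho), for a state value function V. *)
Definition avg (rho V : S -> R) : R := \sum_s rho s * V s.

Definition opt_actions (s : S) : {set A} :=
  [set a | [forall b, Astar s b <= Astar s a]]%SET.

Definition nontriv_states : {set S} :=
  [set s | opt_actions s != [set: A]]%SET.

Definition gap : R :=
  min_over [set x : S * A | x.1 \in nontriv_states /\ x.2 \notin opt_actions x.1]
    (fun x => `|Astar x.1 x.2|).

Definition is_ppg (mu : S -> R) (eta : nat -> R) (pi : nat -> S -> A -> R) :
    Prop :=
  forall k s,
    is_simplex_proj
      (fun a => pi k s a +
         eta k / (1 - gamma) * visitation mu (pi k) s * Qpi (pi k) s a)
      (pi k.+1 s).

Definition C1 (mu : S -> R) (eta : R) : R :=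
  (2 + 5 * #|A|%:R) / (eta * min_over setT mu).

Definition C2 (mu rho : S -> R) (eta : R) : R :=
  min_over setT rho * gap / 2 *
  (eta * min_over setT mu * gap / (1 + eta * min_over setT mu * gap)).

End MDP.

(* Main.v *)
Require Import Defs.
From mathcomp Require Import all_boot all_order all_algebra.
From mathcomp Require Import all_classical all_reals all_analysis.
From mathcomp Require Import ring lra.

Import Order.TTheory GRing.Theory Num.Theory.
Import numFieldNormedType.Exports.
Local Open Scope ring_scope.

(* The suboptimality of one iterate contracts, for one of two reasons.  If it
   is at least [C2], the variational inequality of the projection bounds the
   improvement at each state below by [m^2 / (m + C1)], where [m] is the largest
   advantage at that state; averaging over the visitation measure of [pistar]
   and applying the performance difference lemma twice gives the rate.  If it
   is below [C2], then at every state [pi k] has so little mass on suboptimal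
   actions, and the values separate them so clearly from optimal ones, that the
   projection removes them entirely: [pi k.+1] is optimal. *)

(** * Projection onto the simplex *)

Lemma simplex_le1 {R : realType} {I : finType} {p : I -> R} :
  simplex p -> forall i, p i <= 1.
Proof.
move=> [p0 <-] i; rewrite (bigD1 i) //= lerDl.
exact: sumr_ge0.
Qed.

Lemma simplex_dirac (R : realType) (I : finType) (i : I) :
  simplex (fun j => (j == i)%:R : R).
Proof.
split=> [j|]; first by rewrite ler0n.
by rewrite (bigD1 i) //= eqxx big1 ?addr0 // => j /negbTE ->.
Qed.

Lemma sum_diracM (R : realType) (I : finType) (i : I) (g : I -> R) :
  \sum_j (j == i)%:R * g j = g i.
Proof.
rewrite (bigD1 i) //= eqxx mul1r big1 ?addr0 // => j /negbTE ->.
by rewrite mul0r.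
Qed.

(** Entries lie in [0, 1], so each [(q i - p i) ^+ 2] is at most [q i + p i]. *)
Lemma simplex_dist2_le2 (R : realType) (I : finType) (p q : I -> R) :
  simplex p -> simplex q -> \sum_i (q i - p i) ^+ 2 <= 2.
Proof.
move=> ps qs; have [p0 p1] := ps; have [q0 q1] := qs.
apply: (@le_trans _ _ (\sum_i (q i + p i))); last by rewrite big_split /= p1 q1.
apply: ler_sum => i _.
have := simplex_le1 ps i; have := simplex_le1 qs i.
have := p0 i; have := q0 i; nra.
Qed.

Section SimplexProjection.
Context {R : realType} {I : finType}.

Lemma simplex_proj_variational (y p q : I -> R) :
  is_simplex_proj y p -> simplex q ->
  \sum_i (y i - p i) * (q i - p i) <= 0.
Proof.
move=> [ps pmin] qs; have [p0 p1] := ps; have [q0 q1] := qs.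
set L := \sum_i _; set N := \sum_i (q i - p i) ^+ 2.
have N0 : 0 <= N by apply: sumr_ge0 => i _; rewrite sqr_ge0.
(* Minimality of [p] against the point at fraction [t] of the segment from [p] to [q]. *)
have mix t : 0 <= t <= 1 -> 0 <= t * (t * N - 2 * L).
  move=> /andP[t0 t1].
  have rs : simplex (fun i => p i + t * (q i - p i)).
    split=> [i|]; first by have := p0 i; have := q0 i; nra.
    by rewrite big_split /= -mulr_sumr sumrB p1 q1 subrr mulr0 addr0.
  have := pmin _ rs; rewrite ler_sqrt; last first.
    by apply: sumr_ge0 => i _; rewrite sqr_ge0.
  rewrite -subr_ge0 -sumrB; congr (_ <= _).
  rewrite !mulrBr /N /L !mulr_sumr -sumrB.
  by apply: eq_bigr => i _; ring.
rewrite leNgt; apply/negP => L0.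
have LN : 0 < L + N by rewrite ltr_wpDr.
(* This [t] is admissible even when [N = 0]; it gives [t * N <= L], which contradicts [mix] if
   [L > 0]. *)
have t01 : 0 < L / (L + N) <= 1.
  by rewrite divr_gt0 //= ler_pdivrMr // mul1r lerDl.
have [/andP[t0 t1]] := (t01, mix (L / (L + N))).
rewrite (ltW t0) t1 => /(_ isT); rewrite pmulr_rge0 // => h.
have : L / (L + N) * N <= L.
  by rewrite mulrAC ler_pdivrMr // ler_pM2l // lerDr ltW.
lra.
Qed.

Lemma simplex_proj_kkt (y p : I -> R) (a b : I) :
  is_simplex_proj y p -> 0 < p b -> y a - p a <= y b - p b.
Proof.
move=> yp pb; have [[p0 p1] _] := yp.
have [->//|ab] := eqVneq a b.
(* The test point moves the whole mass at [b] to [a]. *)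
pose q i := p i + p b * ((i == a)%:R - (i == b)%:R).
have qs : simplex q.
  split=> [i|].
    rewrite /q; have := p0 i; have := p0 b.
    have [->|ia] := eqVneq i a; first by rewrite (negbTE ab) /=; lra.
    by have [->|ib] := eqVneq i b => /=; lra.
  rewrite /q big_split /= p1 -mulr_sumr sumrB.
  have [_ ->] := simplex_dirac R I a; have [_ ->] := simplex_dirac R I b.
  by rewrite subrr mulr0 addr0.
have := simplex_proj_variational _ _ _ yp qs.
have -> : \sum_i (y i - p i) * (q i - p i) =
          p b * (\sum_i (i == a)%:R * (y i - p i)
                 - \sum_i (i == b)%:R * (y i - p i)).
  by rewrite -sumrB mulr_sumr; apply: eq_bigr => i _; rewrite /q; ring.
by rewrite !sum_diracM pmulr_rle0 // subr_le0.
Qed.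

(* Testing the variational inequality at [p] gives [h F >= |p' - p|^2]; testing
   it at the vertex [a] gives [h (m - F) <= <p' - p, e_a - p'>], which is at
   most [2] and, by Cauchy-Schwarz, at most [sqrt (2 h F)]. *)
Lemma simplex_proj_improvement (p p' q : I -> R) (h : R) (a : I) :
  0 < h -> simplex p -> is_simplex_proj (fun i => p i + h * q i) p' ->
  (forall i, q i <= q a) ->
  let F := \sum_i p' i * q i - \sum_i p i * q i in
  let m := q a - \sum_i p i * q i in
  0 <= F <= m /\ m ^+ 2 <= F * (m + 4 / h).
Proof.
move=> h0 ps pp' qmax; have [p's _] := pp'.
have [p'0 p'1] := p's; have [p0 p1] := ps.
set v0 := \sum_i p i * q i; set v1 := \sum_i p' i * q i => F m.
pose u i := p' i - p i; pose v i := (i == a)%:R - p' i.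
set U := \sum_i u i ^+ 2; set V := \sum_i v i ^+ 2.
set D := \sum_i u i * v i.
have es := simplex_dirac R I a.
have U2 : U <= 2 by exact: simplex_dist2_le2.
have V2 : V <= 2 by exact: simplex_dist2_le2.
have FU : U <= h * F.
  have := simplex_proj_variational _ _ _ pp' ps.
  have -> : \sum_i (p i + h * q i - p' i) * (p i - p' i) = U + h * (v0 - v1).
    rewrite /U -sumrB mulr_sumr -big_split /=.
    by apply: eq_bigr => i _; rewrite /u; ring.
  by rewrite /F; lra.
have Dm : h * (m - F) <= D.
  have := simplex_proj_variational _ _ _ pp' es.
  have -> : \sum_i (p i + h * q i - p' i) * ((i == a)%:R - p' i) =
    h * (\sum_i (i == a)%:R * q i - v1) - D.
    rewrite /D -sumrB mulr_sumr -sumrB.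
    by apply: eq_bigr => i _; rewrite /u /v; ring.
  by rewrite sum_diracM /F /m; lra.
have U0 : 0 <= U by apply: sumr_ge0 => i _; rewrite sqr_ge0.
have F0 : 0 <= F by rewrite -(pmulr_rge0 _ h0) (le_trans U0).
have Fm : F <= m.
  rewrite lerD2r -[leRHS]mul1r -p'1 mulr_suml; apply: ler_sum => i _.
  exact: ler_wpM2l.
have D2 : D <= 2.
  have : 0 <= \sum_i (u i - v i) ^+ 2.
    by apply: sumr_ge0 => i _; rewrite sqr_ge0.
  have -> : \sum_i (u i - v i) ^+ 2 = U - 2 * D + V.
    rewrite /U /D /V mulr_sumr -sumrB -big_split /=.
    by apply: eq_bigr => i _; ring.
  lra.
set w := h * (m - F).
have w0 : 0 <= w by rewrite mulr_ge0 ?subr_ge0 // ltW.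
(* Cauchy-Schwarz without square roots: the multipliers 2 and [w] are balanced for [V <= 2], and
   [w <= D] bounds the cross term. *)
have w2 : w ^+ 2 <= 2 * (h * F).
  have : 0 <= \sum_i (2 * u i - w * v i) ^+ 2.
    by apply: sumr_ge0 => i _; rewrite sqr_ge0.
  have -> : \sum_i (2 * u i - w * v i) ^+ 2 = 4 * U - 4 * (w * D) + w ^+ 2 * V.
    rewrite /U /D /V !mulr_sumr -sumrB -big_split /=.
    by apply: eq_bigr => i _; ring.
  have : w * w <= w * D by apply: ler_wpM2l.
  have : w ^+ 2 * V <= w ^+ 2 * 2 by apply: ler_wpM2l => //; rewrite sqr_ge0.
  rewrite expr2; lra.
split; first by rewrite F0 Fm.
have hF0 : 0 <= h * F by rewrite mulr_ge0 // ltW.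
have Fw : h * F * w <= h * F * 2 by apply: ler_wpM2l => //; apply: le_trans D2.
rewrite -(ler_pM2l (exprn_gt0 2 h0)).
have -> : h ^+ 2 * (F * (m + 4 / h)) = h ^+ 2 * F * m + 4 * (h * F).
  by field; rewrite gt_eqF.
(* This is [h * m = h * F + w] used twice. The first two terms are at most [2 * (h * F)] each,
   whence the 4 in [4 / h]. *)
have -> : h ^+ 2 * m ^+ 2 = w ^+ 2 + h * F * w + h ^+ 2 * F * m.
  by rewrite /w; ring.
lra.
Qed.

(* A coordinate [b] outside [B] that stays positive would, by KKT, make every
   coordinate in [B] grow by more than the mass [p] has outside [B]. *)
Lemma simplex_proj_support (p p' q : I -> R) (h g : R) (B : {set I}) (b : I) :
  simplex p -> is_simplex_proj (fun i => p i + h * q i) p' ->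
  0 <= h -> B != finset.set0 ->
  (forall i j, i \in B -> j \notin B -> g <= q i - q j) ->
  2 * (\sum_(j | j \notin B) p j) <= h * g ->
  b \notin B -> p' b = 0.
Proof.
move=> [p0 p1] pp' h0 /set0Pn[a0 a0B] qg small bB.
have [[p'0 p'1] _] := pp'.
set beta := \sum_(j | _) p j in small.
apply/le_anti; rewrite p'0 andbT leNgt; apply/negP => p'b.
have pb : p b <= beta by rewrite /beta (bigD1 b) //= lerDl sumr_ge0.
(* By KKT the gain at [i] is at least [h * g - p b + p' b], where [h * g >= 2 * beta] and
   [p b <= beta]. *)
have grow i : i \in B -> p i + beta + p' b <= p' i.
  move=> iB; have := simplex_proj_kkt _ _ i b pp' p'b.
  have : h * g <= h * (q i - q b) by rewrite ler_wpM2l // qg.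
  rewrite mulrBr; lra.
have beta0 : 0 <= beta by rewrite /beta sumr_ge0.
(* Crediting the gain to [a0] alone suffices: the rest of [B] loses nothing, so [p'] would have mass
   at least [1 + p' b] on [B]. *)
have sumB : \sum_(i in B) p i + beta + p' b <= \sum_(i in B) p' i.
  rewrite (bigD1 a0) //= [leRHS](bigD1 a0) //=.
  have : \sum_(i in B | i != a0) p i <= \sum_(i in B | i != a0) p' i.
    by apply: ler_sum => i /andP[iB _]; have := grow i iB; lra.
  have := grow a0 a0B; lra.
have tot : \sum_(i in B) p i + beta = 1.
  by rewrite -p1 [RHS](bigID (mem B)).
have : \sum_(i in B) p' i + \sum_(i | i \notin B) p' i = 1.
  by rewrite -p'1 [RHS](bigID (mem B)).
have : 0 <= \sum_(i | i \notin B) p' i by rewrite sumr_ge0.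
lra.
Qed.

End SimplexProjection.

(** * Discounted expectations along trajectories *)

Section ConsFfun.
Context {T : finType} {n : nat}.

Definition cons_ffun (x : T) (g : {ffun 'I_n -> T}) : {ffun 'I_n.+1 -> T} :=
  [ffun i => if unlift ord0 i is Some j then g j else x].

Lemma cons_ffun0 x g : cons_ffun x g ord0 = x.
Proof. by rewrite ffunE unlift_none. Qed.

Lemma cons_ffun_lift x g j : cons_ffun x g (lift ord0 j) = g j.
Proof. by rewrite ffunE liftK. Qed.

(** Splitting off the first entry allows induction on the horizon for sums over trajectories. *)
Lemma big_cons_ffun (V : nmodType) (F : {ffun 'I_n.+1 -> T} -> V) :
  \sum_tau F tau = \sum_x \sum_g F (cons_ffun x g).
Proof.
rewrite pair_big /= (reindex (fun xg => cons_ffun xg.1 xg.2)) //=.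
exists (fun tau => (tau ord0, [ffun j => tau (lift ord0 j)])).
  move=> [x g] _ /=; rewrite cons_ffun0; congr (_, _).
  by apply/ffunP => j; rewrite ffunE cons_ffun_lift.
move=> tau _; apply/ffunP => i; case: (unliftP ord0 i) => [j ->|->].
  by rewrite cons_ffun_lift ffunE.
by rewrite cons_ffun0.
Qed.

End ConsFfun.

(** Minimum principle: at a minimizer [i0] the average of [g] is at least [g i0], so
    [c * g i0 <= g i0] with [c < 1]. *)
Lemma discounted_superharmonic_ge0 (R : realType) (I : finType)
    (K : I -> I -> R) (c : R) (g : I -> R) :
  0 <= c < 1 -> (forall i, simplex (K i)) ->
  (forall i, c * \sum_j K i j * g j <= g i) -> forall i, 0 <= g i.
Proof.
move=> /andP[c0 c1] Ks gK i.
case: (arg_minP g (erefl : xpredT i)) => i0 _ i0min.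
apply: le_trans (i0min i isT); have [K0 K1] := Ks i0.
have : g i0 <= \sum_j K i0 j * g j.
  rewrite -[leLHS]mul1r -K1 mulr_suml; apply: ler_sum => j _.
  by apply: ler_wpM2l; [exact: K0|exact: i0min].
by have := gK i0; nra.
Qed.

Lemma discounted_fixpoint_unique (R : realType) (I : finType)
    (K : I -> I -> R) (c : R) (f g1 g2 : I -> R) :
  0 <= c < 1 -> (forall i, simplex (K i)) ->
  (forall i, g1 i = f i + c * \sum_j K i j * g1 j) ->
  (forall i, g2 i = f i + c * \sum_j K i j * g2 j) ->
  g1 =1 g2.
Proof.
move=> c01 Ks e1 e2 i.
have sumB (h1 h2 : I -> R) k :
    \sum_j K k j * (h1 j - h2 j) = \sum_j K k j * h1 j - \sum_j K k j * h2 j.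
  by rewrite -sumrB; apply: eq_bigr => j _; rewrite mulrBr.
apply/le_anti/andP; split; rewrite -subr_ge0.
  apply: (discounted_superharmonic_ge0 R I K c (fun i => g2 i - g1 i)) => // k.
  by rewrite sumB; have := e1 k; have := e2 k; lra.
apply: (discounted_superharmonic_ge0 R I K c (fun i => g1 i - g2 i)) => // k.
by rewrite sumB; have := e1 k; have := e2 k; lra.
Qed.

Section Trajectories.
Context {R : realType} {S A : finType} (M : mdp R S A).
Variables (pi : S -> A -> R) (pi_policy : is_policy pi).
Local Notation gamma := (discount M).

Definition sa_kernel (x y : S * A) : R := trans M x.1 x.2 y.1 * pi y.1 y.2.

Definition state_kernel (s t : S) : R := \sum_a pi s a * trans M s a t.

Lemma sum_policyM (g : S -> R) :
  \sum_(y : S * A) g y.1 * pi y.1 y.2 = \sum_s g s.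
Proof.
rewrite -(pair_bigA _ (fun s a => g s * pi s a)) /=.
apply: eq_bigr => s _; have [_ p1] := pi_policy s.
by rewrite -mulr_sumr p1 mulr1.
Qed.

Lemma simplex_sa_kernel x : simplex (sa_kernel x).
Proof.
have [t0 t1] := trans_simplex M x.1 x.2; split=> [y|].
  by have [p0 _] := pi_policy y.1; rewrite mulr_ge0.
by rewrite sum_policyM.
Qed.

Lemma simplex_state_kernel s : simplex (state_kernel s).
Proof.
have [p0 p1] := pi_policy s; split=> [t|].
  apply: sumr_ge0 => a _; have [t0 _] := trans_simplex M s a.
  by rewrite mulr_ge0.
rewrite exchange_big /= -p1; apply: eq_bigr => a _.
by have [_ t1] := trans_simplex M s a; rewrite -mulr_sumr t1 mulr1.
Qed.

(** Markov property: after the first pair [x], the rest is a trajectory with initial law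
    [sa_kernel x]. *)
Lemma traj_prob_cons x0 n x (g : {ffun 'I_n.+1 -> S * A}) :
  traj_prob M pi x0 (n := n.+1) (cons_ffun x g) =
  x0 x * traj_prob M pi (sa_kernel x) g.
Proof.
rewrite /traj_prob cons_ffun0 big_ord_recl /=; congr (x0 x * _); congr (_ * _).
  have -> : widen_ord (leqnSn n.+1) ord0 = ord0 by apply: val_inj.
  by rewrite cons_ffun0 cons_ffun_lift.
apply: eq_bigr => t _.
have -> : widen_ord (leqnSn n.+1) (lift ord0 t) =
          lift ord0 (widen_ord (leqnSn n) t) by apply: val_inj.
by rewrite !cons_ffun_lift.
Qed.

Lemma traj_prob0 x0 x (g : {ffun 'I_0 -> S * A}) :
  traj_prob M pi x0 (n := 0) (cons_ffun x g) = x0 x.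
Proof. by rewrite /traj_prob cons_ffun0 big_ord0 mulr1. Qed.

Lemma sum_ffun0 (r : R) : \sum_(g : {ffun 'I_0 -> S * A}) r = r.
Proof. by rewrite sumr_const card_ffun card_ord expn0 mulr1n. Qed.

Lemma traj_prob_total x0 n :
  \sum_(tau : {ffun 'I_n.+1 -> S * A}) traj_prob M pi x0 tau = \sum_x x0 x.
Proof.
elim: n x0 => [|n IHn] x0; rewrite big_cons_ffun; apply: eq_bigr => x _.
  by under eq_bigr do rewrite traj_prob0; rewrite sum_ffun0.
under eq_bigr do rewrite traj_prob_cons.
have [_ k1] := simplex_sa_kernel x.
by rewrite -mulr_sumr IHn k1 mulr1.
Qed.

(** Policy evaluation by backward recursion; horizon [n] counts the [n.+1] times 0 to [n], as in
    [disc_expect]. *)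
Fixpoint horizon_value (f : S * A -> R) (n : nat) (x : S * A) : R :=
  if n is m.+1 then f x + gamma * \sum_y sa_kernel x y * horizon_value f m y
  else f x.

Lemma traj_expectE x0 f n :
  \sum_(tau : {ffun 'I_n.+1 -> S * A})
    traj_prob M pi x0 tau * (\sum_(t < n.+1) gamma ^+ t * f (tau t)) =
  \sum_x x0 x * horizon_value f n x.
Proof.
elim: n x0 => [|n IHn] x0; rewrite big_cons_ffun; apply: eq_bigr => x _.
  under eq_bigr do rewrite traj_prob0 big_ord1 cons_ffun0 expr0 mul1r.
  by rewrite sum_ffun0.
have [_ k1] := simplex_sa_kernel x.
rewrite /= -IHn mulrDr mulr_sumr mulr_sumr.
(* The first cost [f x] is spread over all continuations, whose probabilities sum to 1, so that both
   sides become sums over tails. *)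
rewrite -[in x0 x * f x](mul1r (f x)) -k1 -(traj_prob_total _ n).
rewrite mulr_suml mulr_sumr -big_split /=; apply: eq_bigr => g _.
rewrite traj_prob_cons big_ord_recl cons_ffun0 expr0 mul1r.
under [X in _ * (_ + X) = _]eq_bigr do rewrite cons_ffun_lift exprS -mulrA.
by rewrite -mulr_sumr; ring.
Qed.

Section BoundedCost.
Variables (f : S * A -> R) (f01 : forall x, 0 <= f x <= 1).

Lemma horizon_value_bound n x : 0 <= horizon_value f n x <= (1 - gamma)^-1.
Proof.
have /andP[g0 g1] := discount_bounded M.
have g1' : 0 < 1 - gamma by rewrite subr_gt0.
have c1 : 1 <= (1 - gamma)^-1 by rewrite invf_ge1 //; lra.
elim: n x => [|n IHn] x /=; have /andP[f0 f1] := f01 x.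
  by rewrite f0 (le_trans f1).
have [k0 k1] := simplex_sa_kernel x; apply/andP; split.
  rewrite addr_ge0 // mulr_ge0 // sumr_ge0 // => y _.
  by rewrite mulr_ge0 //; case/andP: (IHn y).
have : \sum_y sa_kernel x y * horizon_value f n y <= (1 - gamma)^-1.
  rewrite -[leRHS]mul1r -[X in _ <= X * _]k1 mulr_suml; apply: ler_sum => y _.
  by apply: ler_wpM2l => //; case/andP: (IHn y).
move=> /(ler_wpM2l g0) h; apply: (le_trans (lerD f1 h)).
by rewrite le_eqVlt; apply/orP; left; apply/eqP; field; rewrite gt_eqF.
Qed.

Lemma horizon_value_nondecreasing x :
  {homo (fun n => horizon_value f n x) : m n / (m <= n)%N >-> m <= n}.
Proof.
apply/nondecreasing_seqP => n.
have /andP[g0 g1] := discount_bounded M.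
elim: n x => [|n IHn] x /=; have [k0 k1] := simplex_sa_kernel x.
  rewrite lerDl mulr_ge0 // sumr_ge0 // => y _.
  by rewrite mulr_ge0 //; case/andP: (f01 y).
by rewrite lerD2l ler_wpM2l // ler_sum // => y _; rewrite ler_wpM2l.
Qed.

Definition action_value (x : S * A) : R := limn (fun n => horizon_value f n x).

(** Since [f >= 0] the truncated values increase, and since [f <= 1] they stay below the geometric
    sum; hence [limn] is a genuine limit here. *)
Lemma cvg_horizon_value x :
  ((fun n => horizon_value f n x) @ \oo --> action_value x)%classic.
Proof.
apply: nondecreasing_is_cvgn; first exact: horizon_value_nondecreasing.
exists (1 - gamma)^-1 => _ [n _ <-].
by case/andP: (horizon_value_bound n x).
Qed.

Lemma cvg_sum_horizon_value (x0 : S * A -> R) :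
  ((fun n => \sum_x x0 x * horizon_value f n x) @ \oo -->
   \sum_x x0 x * action_value x)%classic.
Proof.
apply: cvg_big => [|x _]; first exact: add_continuous.
by apply: cvgMr; exact: cvg_horizon_value.
Qed.

Lemma disc_expectE x0 :
  disc_expect M pi x0 f = \sum_x x0 x * action_value x.
Proof.
rewrite /disc_expect; under eq_fun do rewrite traj_expectE.
by apply: cvg_lim => //; exact: cvg_sum_horizon_value.
Qed.

Lemma action_valueE x :
  action_value x = f x + gamma * \sum_y sa_kernel x y * action_value y.
Proof.
have h := cvg_horizon_value x.
rewrite -(cvg_shiftS (fun n => horizon_value f n x)) in h.
apply: (cvg_unique _ h) => //=.
apply: cvgD; first exact: cvg_cst.
by apply: cvgMr; exact: cvg_sum_horizon_value.
Qed.

Lemma action_value_bound x : 0 <= action_value x <= (1 - gamma)^-1.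
Proof.
have h := cvg_horizon_value x.
apply/andP; split; rewrite -(cvg_lim _ h) //.
  apply: limr_ge; first by apply/cvg_ex; exists (action_value x).
  by near=> n; case/andP: (horizon_value_bound n x).
apply: limr_le; first by apply/cvg_ex; exists (action_value x).
by near=> n; case/andP: (horizon_value_bound n x).
Unshelve. all: by end_near.
Qed.

End BoundedCost.
End Trajectories.

(** * Values, visitation measures and optimality *)

Section Values.
Context {R : realType} {S A : finType} (M : mdp R S A).
Local Notation gamma := (discount M).

(** The one-step Bellman backup: it yields [Qpi] from [Vpi] and [Qstar] from [Vstar]. *)
Definition lookahead (V : S -> R) (s : S) (a : A) : R :=
  reward M s a + gamma * \sum_t trans M s a t * V t.

Lemma lookahead_mono (V W : S -> R) s a :
  (forall t, V t <= W t) -> lookahead V s a <= lookahead W s a.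
Proof.
move=> VW; have /andP[g0 _] := discount_bounded M.
have [t0 _] := trans_simplex M s a.
by rewrite lerD2l ler_wpM2l // ler_sum // => t _; rewrite ler_wpM2l.
Qed.

Section FixedPolicy.
Variables (pi : S -> A -> R) (pi_policy : is_policy pi).

Lemma sum_start (nu : S -> R) (g : S * A -> R) :
  \sum_x start nu pi x * g x = \sum_s nu s * \sum_a pi s a * g (s, a).
Proof.
transitivity (\sum_s \sum_a start nu pi (s, a) * g (s, a)).
  by rewrite pair_bigA; apply: eq_bigr => -[].
by apply: eq_bigr => s _; rewrite mulr_sumr; apply: eq_bigr => a _; rewrite mulrA.
Qed.

Lemma reward01 (x : S * A) : 0 <= reward M x.1 x.2 <= 1.
Proof. exact: reward_bounded. Qed.

Lemma QpiE s a :
  Qpi M pi s a = action_value M pi (fun x => reward M x.1 x.2) (s, a).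
Proof. by rewrite /Qpi disc_expectE ?sum_diracM // => x; exact: reward01. Qed.

Lemma VpiE s : Vpi M pi s = \sum_a pi s a * Qpi M pi s a.
Proof.
rewrite /Vpi disc_expectE // => [|x]; last exact: reward01.
rewrite sum_start sum_diracM.
by apply: eq_bigr => a _; rewrite QpiE.
Qed.

Lemma QpiE_lookahead s a : Qpi M pi s a = lookahead (Vpi M pi) s a.
Proof.
rewrite QpiE action_valueE // => [|x]; last exact: reward01.
congr (_ + _ * _); rewrite (sum_start (trans M s a)).
apply: eq_bigr => t _; rewrite VpiE; congr (_ * _).
by apply: eq_bigr => b _; rewrite QpiE.
Qed.

Lemma lookahead_policyE (V : S -> R) s :
  \sum_a pi s a * lookahead V s a =
  \sum_a pi s a * reward M s a + gamma * \sum_t state_kernel M pi s t * V t.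
Proof.
under eq_bigr do rewrite mulrDr; rewrite big_split /=; congr (_ + _).
under [in RHS]eq_bigr do rewrite mulr_suml.
rewrite exchange_big mulr_sumr /=; apply: eq_bigr => a _.
rewrite mulrCA; congr (_ * _); rewrite mulr_sumr.
by apply: eq_bigr => t _; rewrite mulrA.
Qed.

Lemma Vpi_bellman s : Vpi M pi s = \sum_a pi s a * lookahead (Vpi M pi) s a.
Proof. by rewrite {1}VpiE; apply: eq_bigr => a _; rewrite QpiE_lookahead. Qed.

Lemma Qpi_bound s a : 0 <= Qpi M pi s a <= (1 - gamma)^-1.
Proof. by rewrite QpiE action_value_bound // => x; exact: reward01. Qed.

Lemma Vpi_bound s : Vpi M pi s <= (1 - gamma)^-1.
Proof.
have [p0 p1] := pi_policy s.
rewrite VpiE -[leRHS]mul1r -[X in _ <= X * _]p1 mulr_suml.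
apply: ler_sum => a _; apply: ler_wpM2l => //.
by case/andP: (Qpi_bound s a).
Qed.

Lemma Vpi_unique (V : S -> R) :
  (forall s, V s = \sum_a pi s a * lookahead V s a) -> V =1 Vpi M pi.
Proof.
move=> h; apply: (discounted_fixpoint_unique _ _ (state_kernel M pi) gamma
  (fun s => \sum_a pi s a * reward M s a)).
- exact: discount_bounded.
- exact: simplex_state_kernel.
- by move=> s; rewrite {1}h lookahead_policyE.
- by move=> s; rewrite {1}Vpi_bellman lookahead_policyE.
Qed.

(** By the Bellman equation of [pi], the difference [Vpi M pi - V] satisfies the hypothesis of the
    minimum principle. *)
Lemma policy_improvement (V : S -> R) :
  (forall s, V s <= \sum_a pi s a * lookahead V s a) ->
  forall s, V s <= Vpi M pi s.
Proof.
move=> h s; rewrite -subr_ge0.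
apply: (discounted_superharmonic_ge0 _ _ (state_kernel M pi) gamma
  (fun t => Vpi M pi t - V t)).
- exact: discount_bounded.
- exact: simplex_state_kernel.
move=> t; under eq_bigr do rewrite mulrBr; rewrite sumrB mulrBr.
have := h t; have := Vpi_bellman t; rewrite !lookahead_policyE; lra.
Qed.

(** The Green function of the discounted state chain: expected discounted visits to the target [s]
    from the start [s0]. *)
Definition occupancy (s s0 : S) : R :=
  \sum_a pi s0 a * action_value M pi (fun x => (x.1 == s)%:R) (s0, a).

Lemma indicator01 (s : S) (x : S * A) : 0 <= ((x.1 == s)%:R : R) <= 1.
Proof. by case: eqP => _; rewrite lexx ler01. Qed.

Lemma occupancy_ge0 s s0 : 0 <= occupancy s s0.
Proof.
have [p0 _] := pi_policy s0; apply: sumr_ge0 => a _; rewrite mulr_ge0 //.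
by case/andP: (action_value_bound M pi pi_policy _ (indicator01 s) (s0, a)).
Qed.

Lemma occupancyE s s0 :
  occupancy s s0 =
  (s0 == s)%:R + gamma * \sum_t state_kernel M pi s0 t * occupancy s t.
Proof.
have [_ p1] := pi_policy s0.
rewrite {1}/occupancy; under eq_bigr => a _.
  rewrite (action_valueE M pi pi_policy _ (indicator01 s)) /= mulrDr.
  rewrite (sum_start (trans M s0 a)) mulrCA.
  over.
rewrite big_split /= -mulr_suml p1 mul1r -mulr_sumr; congr (_ + _ * _).
under [in RHS]eq_bigr do rewrite mulr_suml.
rewrite exchange_big /=; apply: eq_bigr => a _; rewrite mulr_sumr.
by apply: eq_bigr => t _; rewrite mulrA.
Qed.

Lemma occupancy_diag s : 1 <= occupancy s s.
Proof.
have /andP[g0 _] := discount_bounded M.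
rewrite occupancyE eqxx lerDl mulr_ge0 // sumr_ge0 // => t _.
have [k0 _] := simplex_state_kernel M pi pi_policy s.
by rewrite mulr_ge0 // occupancy_ge0.
Qed.

Lemma visitationE nu s :
  visitation M nu pi s = (1 - gamma) * \sum_s0 nu s0 * occupancy s s0.
Proof.
by rewrite /visitation disc_expectE ?sum_start // => x; exact: indicator01.
Qed.

(** Keep only the starts at [s], each of which already visits [s] at time 0. *)
Lemma visitation_ge nu s : simplex nu ->
  (1 - gamma) * nu s <= visitation M nu pi s.
Proof.
move=> [n0 n1]; have /andP[_ g1] := discount_bounded M.
rewrite visitationE ler_pM2l ?subr_gt0 // (bigD1 s) //=.
rewrite -[leLHS]addr0 lerD //.
  by rewrite ler_peMr // occupancy_diag.
by rewrite sumr_ge0 // => t _; rewrite mulr_ge0 // occupancy_ge0.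
Qed.

(** Integrating [g] against [occupancy] gives a solution of the fixed-point equation of [w], and
    that solution is unique. *)
Lemma sum_visitationM nu (g w : S -> R) :
  (forall s, w s = g s + gamma * \sum_t state_kernel M pi s t * w t) ->
  \sum_s visitation M nu pi s * g s = (1 - gamma) * \sum_s nu s * w s.
Proof.
move=> hw.
have occw : (fun s0 => \sum_s occupancy s s0 * g s) =1 w.
  apply: (discounted_fixpoint_unique _ _ (state_kernel M pi) gamma g) => //.
  - exact: discount_bounded.
  - exact: simplex_state_kernel.
  move=> s0; under eq_bigr do rewrite occupancyE mulrDl.
  rewrite big_split /=; congr (_ + _).
    by under eq_bigr do rewrite eq_sym; rewrite sum_diracM.
  under eq_bigr do rewrite -mulrA mulr_suml.
  rewrite -mulr_sumr exchange_big /=; congr (_ * _).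
  apply: eq_bigr => t _; rewrite mulr_sumr.
  by apply: eq_bigr => s _; rewrite mulrA.
under eq_bigr do rewrite visitationE -mulrA mulr_suml.
rewrite -mulr_sumr exchange_big /=; congr (_ * _).
apply: eq_bigr => s0 _; rewrite -occw mulr_sumr.
by apply: eq_bigr => s _; rewrite mulrA.
Qed.

Lemma simplex_visitation nu : simplex nu -> simplex (visitation M nu pi).
Proof.
move=> ns; have [n0 n1] := ns; have /andP[g0 g1] := discount_bounded M.
have g1' : 0 < 1 - gamma by rewrite subr_gt0.
split=> [s|].
  by apply: le_trans (visitation_ge _ s ns); rewrite mulr_ge0 // ltW.
transitivity (\sum_s visitation M nu pi s * 1).
  by apply: eq_bigr => s _; rewrite mulr1.
(* For the constant source 1 the solution is the constant [(1 - gamma)^-1]. *)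
rewrite (sum_visitationM nu _ (fun=> (1 - gamma)^-1)) => [|s].
  by rewrite -mulr_suml n1 mul1r divff // gt_eqF.
have [_ k1] := simplex_state_kernel M pi pi_policy s.
by rewrite -mulr_suml k1; field; rewrite gt_eqF.
Qed.

End FixedPolicy.

(** Subtracting [Vpi M pi s] from the Bellman equation of [pi'] shows that the difference of values
    solves the fixed-point equation whose source is the averaged advantage. *)
Lemma performance_difference (pi pi' : S -> A -> R) (nu : S -> R) :
  is_policy pi -> is_policy pi' ->
  \sum_s visitation M nu pi' s *
    (\sum_a pi' s a * (Qpi M pi s a - Vpi M pi s)) =
  (1 - gamma) * (avg nu (Vpi M pi') - avg nu (Vpi M pi)).
Proof.
move=> pip pip'.
rewrite (sum_visitationM _ pip' nu _ (fun s => Vpi M pi' s - Vpi M pi s)).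
  by congr (_ * _); rewrite /avg -sumrB; apply: eq_bigr => s _; rewrite mulrBr.
move=> s; have [_ p1] := pip' s.
under eq_bigr do rewrite mulrBr QpiE_lookahead //.
rewrite sumrB -mulr_suml p1 mul1r lookahead_policyE.
under [X in _ + gamma * X]eq_bigr do rewrite mulrBr.
rewrite sumrB [Vpi M pi' s]Vpi_bellman // lookahead_policyE; ring.
Qed.

End Values.

(** * Optimal actions and the advantage gap *)

Section Optimality.
Context {R : realType} {S A : finType} (M : mdp R S A).
Local Notation gamma := (discount M).
Local Notation Vs := (Vstar M).
Local Notation Qs := (Qstar M).
Variables (pistar : S -> A -> R) (pistar_opt : is_optimal_policy M pistar).

Lemma Vpi_le_Vstar pi s : is_policy pi -> Vpi M pi s <= Vs s.
Proof.
move=> pip; apply: ub_le_sup; last by exists pi.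
by exists (1 - gamma)^-1 => _ [p pp <-]; exact: Vpi_bound.
Qed.

Lemma Qpi_le_Qstar pi s a : is_policy pi -> Qpi M pi s a <= Qs s a.
Proof.
move=> pip; apply: ub_le_sup; last by exists pi.
by exists (1 - gamma)^-1 => _ [p pp <-]; case/andP: (Qpi_bound M p pp s a).
Qed.

(** Every [Qpi] is the backup of some [Vpi], which is at most [Vstar]; [pistar] attains the
    bound. *)
Lemma Qstar_lookahead s a : Qs s a = lookahead M Vs s a.
Proof.
have [pp Vp] := pistar_opt; apply/le_anti/andP; split.
  apply: ge_sup; first by exists (Qpi M pistar s a), pistar.
  move=> _ [p pp' <-]; rewrite QpiE_lookahead //.
  by apply: lookahead_mono => t; exact: Vpi_le_Vstar.
apply: le_trans (Qpi_le_Qstar _ s a pp); rewrite QpiE_lookahead //.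
by apply: lookahead_mono => t; rewrite Vp.
Qed.

Lemma Vstar_bellman s : Vs s = \sum_a pistar s a * Qs s a.
Proof.
have [pp Vp] := pistar_opt; rewrite -Vp Vpi_bellman //.
apply: eq_bigr => a _; rewrite Qstar_lookahead; congr (_ * _).
by congr (_ + _ * _); apply: eq_bigr => t _; rewrite Vp.
Qed.

(* Otherwise deviating from [pistar] at the single state [s] would be a strict
   improvement. *)
Lemma Astar_le0 s a : Astar M s a <= 0.
Proof.
have [pp Vp] := pistar_opt.
pose p t b : R := if t == s then (b == a)%:R else pistar t b.
have ps : is_policy p.
  move=> t; rewrite /p; have [_|_] := eqVneq t s; last exact: pp.
  exact: simplex_dirac.
have pE : \sum_b p s b * Qs s b = Qs s a.
  by under eq_bigr do rewrite /p eqxx; rewrite sum_diracM.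
rewrite subr_le0 leNgt; apply/negP => lt.
have imp t : Vs t <= \sum_b p t b * lookahead M Vs t b.
  under eq_bigr do rewrite -Qstar_lookahead.
  have [->|ne] := eqVneq t s; first by rewrite pE ltW.
  by rewrite /p (negbTE ne) -Vstar_bellman.
move: lt; apply/negP; rewrite -leNgt.
apply: le_trans (Vpi_le_Vstar _ s ps); rewrite Vpi_bellman //.
rewrite -pE; have [p0 _] := ps s; apply: ler_sum => b _.
rewrite ler_wpM2l // Qstar_lookahead; apply: lookahead_mono => t.
exact: policy_improvement.
Qed.

(** The nonpositive numbers [Astar M s a] have [pistar]-average 0, so they vanish wherever
    [pistar s] has mass. *)
Lemma exists_Astar_eq0 s : exists a, Astar M s a = 0.
Proof.
have [pp Vp] := pistar_opt; have [p0 p1] := pp s.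
have sum0 : \sum_a pistar s a * - Astar M s a = 0.
  under eq_bigr do rewrite opprB mulrBr.
  by rewrite sumrB -mulr_suml p1 mul1r -Vstar_bellman subrr.
have term0 a : pistar s a * - Astar M s a = 0.
  apply: (psumr_eq0P _ sum0) => // b _.
  by rewrite mulr_ge0 // oppr_ge0 Astar_le0.
apply: contrapT => none; move: p1; rewrite big1 => [/eqP|a _].
  by rewrite eq_sym oner_eq0.
have /eqP := term0 a; rewrite mulf_eq0 oppr_eq0 => /orP[/eqP //|/eqP a0].
by case: none; exists a.
Qed.

Lemma opt_actionsE s a : (a \in opt_actions M s) = (Astar M s a == 0).
Proof.
rewrite finset.in_set; apply/forallP/eqP => [h|-> b]; last exact: Astar_le0.
have [b b0] := exists_Astar_eq0 s.
by apply/le_anti; rewrite Astar_le0 -{1}b0 h.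
Qed.

(** On optimal actions [Qstar] equals [Vstar], so [Vstar] solves the Bellman equation of [pi]. *)
Lemma Vpi_opt_actions pi : is_policy pi ->
  (forall s a, a \notin opt_actions M s -> pi s a = 0) ->
  forall s, Vpi M pi s = Vs s.
Proof.
move=> pip pi0 s; apply/esym; move: s; apply: Vpi_unique => // s.
have [_ p1] := pip s; rewrite -[LHS]mul1r -p1 mulr_suml.
apply: eq_bigr => a _; rewrite -Qstar_lookahead.
have [|/pi0 ->] := boolP (a \in opt_actions M s); last by rewrite !mul0r.
by rewrite opt_actionsE subr_eq0 => /eqP ->.
Qed.

Lemma gap_le s a : a \notin opt_actions M s -> gap M <= - Astar M s a.
Proof.
move=> an; rewrite -ler0_norm ?Astar_le0 //.
apply: ge_inf; first by exists 0 => _ [x _ <-].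
exists (s, a) => //=; split=> //; rewrite finset.in_set.
by apply: contra an => /eqP ->; rewrite finset.in_setT.
Qed.

Lemma gap_gt0 : nontriv_states M != finset.set0 -> 0 < gap M.
Proof.
move=> /set0Pn[s sn].
pose P (x : S * A) := x.2 \notin opt_actions M x.1.
have [a an] : exists a, a \notin opt_actions M s.
  apply/existsP; rewrite -negb_forall; apply/forallP => h.
  move: sn; rewrite finset.in_set => /eqP; apply.
  by apply/setP => a; rewrite h finset.in_setT.
have Psa : P (s, a) by [].
(* The infimum is over a finite nonempty set, so it is bounded below by the value at a minimizer,
   which is nonzero. *)
case: (arg_minP (fun x : S * A => `|Astar M x.1 x.2|) Psa) => x Px xmin.
apply: (@lt_le_trans _ _ `|Astar M x.1 x.2|).
  by rewrite normr_gt0 -opt_actionsE.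
apply: lb_le_inf; first by exists `|Astar M s a|, (s, a).
by move=> _ [y [_ yn] <-]; exact: xmin.
Qed.

(** Replacing [Qpi] by [Qstar] in [Vpi] leaves the [pi]-average of [- Astar], which is at least
    [gap] off the optimal actions. This bounds the mass that a nearly optimal policy puts there. *)
Lemma Vstar_subpolicy pi s : is_policy pi ->
  (\sum_(a | a \notin opt_actions M s) pi s a) * gap M <= Vs s - Vpi M pi s.
Proof.
move=> pip; have [p0 p1] := pip s.
apply: (@le_trans _ _ (\sum_a pi s a * - Astar M s a)).
  rewrite mulr_suml [leRHS](bigID [pred a | a \in opt_actions M s]) /=.
  rewrite addrC -[leLHS]addr0 lerD //.
    by apply: ler_sum => a an; rewrite ler_wpM2l // gap_le.
  by apply: sumr_ge0 => a _; rewrite mulr_ge0 // oppr_ge0 Astar_le0.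
rewrite VpiE // -[Vs s]mul1r -p1 mulr_suml -sumrB; apply: ler_sum => a _.
by rewrite -mulrBr opprB ler_wpM2l // lerD2l lerN2 Qpi_le_Qstar.
Qed.

End Optimality.

(** * Projected policy gradient *)

Lemma min_over_le (R : realType) (I : Type) (f : I -> R) (i : I) :
  (forall j, 0 <= f j) -> min_over setT f <= f i.
Proof.
move=> f0; apply: ge_inf; last by exists i.
by exists 0 => _ [j _ <-].
Qed.

Lemma le_norm_infty (R : realType) (I : finType) (v : I -> R) (i : I) :
  v i <= norm_infty v.
Proof. by apply: le_trans (ler_norm _) _; rewrite /norm_infty (bigmax_sup i). Qed.

Section ProjectedPolicyGradient.
Context {R : realType} {S A : finType} (M : mdp R S A).
Variables (mu rho : S -> R).
Hypotheses (mu_simplex : simplex mu) (mu_pos : 0 < min_over setT mu).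
Hypotheses (rho_simplex : simplex rho) (rho_pos : 0 < min_over setT rho).
Variable pistar : S -> A -> R.
Hypothesis pistar_opt : is_optimal_policy M pistar.
Variables (eta : R) (pi pi' : S -> A -> R).
Hypotheses (eta_pos : 0 < eta) (pi_policy : is_policy pi).
Hypothesis pi'_step : forall s, is_simplex_proj
  (fun a => pi s a + eta / (1 - discount M) * visitation M mu pi s * Qpi M pi s a)
  (pi' s).
Local Notation gamma := (discount M).
Local Notation mumin := (min_over setT mu).
Local Notation gap := (gap M).
Local Notation ratio :=
  (norm_infty (fun s => visitation M rho pistar s / rho s)).
Local Notation subopt p := (avg rho (Vstar M) - avg rho (Vpi M p)).

Lemma ppg_policy : is_policy pi'.
Proof. by move=> s; case: (pi'_step s). Qed.

(** The factor [1 - gamma] from [visitation_ge] cancels the one in the step size, leaving a bound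
    uniform in [s]. *)
Lemma ppg_step_size s :
  eta * mumin <= eta / (1 - gamma) * visitation M mu pi s.
Proof.
have /andP[_ g1] := discount_bounded M; have [m0 _] := mu_simplex.
rewrite -mulrA ler_pM2l // ler_pdivlMl ?subr_gt0 //.
apply: le_trans (visitation_ge _ _ pi_policy _ _ mu_simplex).
by rewrite ler_pM2l ?subr_gt0 // min_over_le.
Qed.

Lemma rho_gt0 s : 0 < rho s.
Proof.
by have [r0 _] := rho_simplex; apply: lt_le_trans (min_over_le _ _ _ _ _).
Qed.

Lemma suboptE (p : S -> A -> R) :
  subopt p = \sum_s rho s * (Vstar M s - Vpi M p s).
Proof. by rewrite /avg -sumrB; apply: eq_bigr => s _; rewrite mulrBr. Qed.

Lemma subopt_ge (p : S -> A -> R) s : is_policy p ->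
  min_over setT rho * (Vstar M s - Vpi M p s) <= subopt p.
Proof.
move=> pp; have [r0 _] := rho_simplex.
have V0 t : 0 <= Vstar M t - Vpi M p t by rewrite subr_ge0 Vpi_le_Vstar.
rewrite suboptE (bigD1 s) //= -[leLHS]addr0 lerD //.
  by rewrite ler_wpM2r // min_over_le.
by rewrite sumr_ge0 // => t _; rewrite mulr_ge0.
Qed.

Lemma subopt_ge0 (p : S -> A -> R) : is_policy p -> 0 <= subopt p.
Proof.
move=> pp; have [r0 _] := rho_simplex; rewrite suboptE sumr_ge0 // => s _.
by rewrite mulr_ge0 // subr_ge0 Vpi_le_Vstar.
Qed.

Lemma visitation_le_ratio s : visitation M rho pistar s <= ratio * rho s.
Proof.
rewrite -ler_pdivrMr ?rho_gt0 //.
exact: (le_norm_infty _ _ (fun s => visitation M rho pistar s / rho s)).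
Qed.

(** Sum [visitation_le_ratio] over the states: both distributions have mass 1. *)
Lemma ratio_ge1 : 1 <= ratio.
Proof.
have [pp _] := pistar_opt; have [_ r1] := rho_simplex.
have [_ <-] := simplex_visitation M _ pp _ rho_simplex.
rewrite -[leRHS]mulr1 -[X in _ <= _ * X]r1 mulr_sumr; apply: ler_sum => s _.
exact: visitation_le_ratio.
Qed.

(* [lambda |-> 2 lambda m - lambda^2 (m + C)] are the tangents of the convex
   function [m^2 / (m + C)] bounding the one-step improvement, so averaging
   this bound replaces Jensen's inequality. *)
Lemma ppg_state_improvement (C lambda : R) s :
  4 / (eta * mumin) <= C -> 0 <= lambda <= 1 ->
  0 <= \sum_a pi' s a * (Qpi M pi s a - Vpi M pi s) /\
  (2 * lambda - lambda ^+ 2) *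
     (\sum_a pistar s a * (Qpi M pi s a - Vpi M pi s)) - lambda ^+ 2 * C <=
  \sum_a pi' s a * (Qpi M pi s a - Vpi M pi s).
Proof.
move=> hC /andP[l0 l1].
have [a0 _] := exists_Astar_eq0 M _ pistar_opt s.
case: (arg_maxP (Qpi M pi s) (erefl : xpredT a0)) => a _ amax.
have e0 : 0 < eta * mumin by rewrite mulr_gt0.
have h0 := lt_le_trans e0 (ppg_step_size s).
have [/andP[F0 Fm] Fm2] := simplex_proj_improvement _ _ _ _ a h0 (pi_policy s)
  (pi'_step s) (fun i => amax i isT).
move: F0 Fm Fm2; rewrite -VpiE //.
have advE (p : S -> A -> R) : is_policy p ->
    \sum_b p s b * (Qpi M pi s b - Vpi M pi s) =
    \sum_b p s b * Qpi M pi s b - Vpi M pi s.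
  move=> pp; have [_ p1] := pp s; under eq_bigr do rewrite mulrBr.
  by rewrite sumrB -mulr_suml p1 mul1r.
have [pps _] := pistar_opt.
rewrite (advE _ ppg_policy) (advE _ pps).
set F := \sum_b pi' s b * _ - _; set x := \sum_b pistar s b * _ - _.
set m := Qpi M pi s a - _; set h := _ / _ * _ in h0 *.
move=> F0 Fm Fm2; split=> //.
have xm : x <= m.
  rewrite lerD2r; have [p0 p1] := pps s.
  rewrite -[leRHS]mul1r -p1 mulr_suml; apply: ler_sum => b _.
  by apply: ler_wpM2l; [exact: p0|exact: amax].
have C0 : 0 < C by apply: lt_le_trans hC; rewrite divr_gt0.
have hhC : 4 / h <= C.
  by apply: le_trans hC; rewrite ler_pM2l // lef_pV2 ?posrE // ppg_step_size.
have mC : 0 < m + C by lra.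
have FC : m ^+ 2 <= F * (m + C).
  by apply: le_trans Fm2 _; rewrite ler_wpM2l // lerD2l.
have Fl : 2 * lambda * m - lambda ^+ 2 * (m + C) <= F.
  rewrite -(ler_pM2r mC); apply: le_trans FC; rewrite -subr_ge0.
  have -> : m ^+ 2 - (2 * lambda * m - lambda ^+ 2 * (m + C)) * (m + C) =
            (m - lambda * (m + C)) ^+ 2 by ring.
  exact: sqr_ge0.
(* Passing from [m] to [x] leaves a quantity that [performance_difference] evaluates when averaged
   over the visitation of [pistar]. *)
have : (2 * lambda - lambda ^+ 2) * x <= (2 * lambda - lambda ^+ 2) * m.
  by rewrite ler_wpM2l //; nra.
lra.
Qed.

Lemma ppg_improvement (C lambda : R) :
  4 / (eta * mumin) <= C -> 0 <= lambda <= 1 ->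
  (2 * lambda - lambda ^+ 2) * ((1 - gamma) * subopt pi) - lambda ^+ 2 * C <=
  ratio * (subopt pi - subopt pi').
Proof.
move=> hC l01; have [pps Vp] := pistar_opt.
have /andP[_ g1] := discount_bounded M.
have avgE : avg rho (Vstar M) = avg rho (Vpi M pistar).
  by apply: eq_bigr => s _; rewrite Vp.
pose x s := \sum_a pistar s a * (Qpi M pi s a - Vpi M pi s).
pose F s := \sum_a pi' s a * (Qpi M pi s a - Vpi M pi s).
have [d0 d1] := simplex_visitation M _ pps _ rho_simplex.
apply: (@le_trans _ _ (\sum_s visitation M rho pistar s * F s)).
  rewrite avgE -performance_difference // -/x mulr_sumr.
  rewrite -[lambda ^+ 2 * C]mul1r -[X in _ - X * _ <= _]d1 mulr_suml -sumrB.
  apply: ler_sum => s _.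
  have [_ hF] := ppg_state_improvement C lambda s hC l01.
  by have := ler_wpM2l (d0 s) hF; rewrite -/(x s) -/(F s); lra.
(* As [F s >= 0], its weight may be raised first to [ratio * rho s], then, through [visitation_ge],
   to a multiple of the visitation of [pi']. *)
apply: (@le_trans _ _ (\sum_s ratio * (rho s * F s))).
  apply: ler_sum => s _; rewrite mulrA ler_wpM2r ?visitation_le_ratio //.
  by have [] := ppg_state_improvement C lambda s hC l01.
rewrite -mulr_sumr ler_wpM2l ?(le_trans ler01 ratio_ge1) //.
have g1' : 0 < 1 - gamma by rewrite subr_gt0.
rewrite -(ler_pM2l g1').
have -> : (1 - gamma) * (subopt pi - subopt pi') =
          (1 - gamma) * (avg rho (Vpi M pi') - avg rho (Vpi M pi)) by ring.
rewrite -performance_difference //; last exact: ppg_policy.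
rewrite mulr_sumr; apply: ler_sum => s _; rewrite mulrA ler_wpM2r //.
  by have [] := ppg_state_improvement C lambda s hC l01.
by apply: visitation_ge => //; exact: ppg_policy.
Qed.

Lemma ppg_terminates : nontriv_states M != finset.set0 ->
  subopt pi < C2 M mu rho eta -> subopt pi' = 0.
Proof.
move=> /(gap_gt0 M _ pistar_opt) gap0 small.
suff Vp' s : Vpi M pi' s = Vstar M s.
  by rewrite suboptE big1 // => s _; rewrite Vp' subrr mulr0.
apply: (Vpi_opt_actions _ _ pistar_opt); first exact: ppg_policy.
move=> {}s b bn.
set e := eta * mumin; have e0 : 0 < e by rewrite mulr_gt0.
pose T := e * gap; have T0 : 0 < T by rewrite mulr_gt0.
(* [C2] is the minimum of [rho] times [gap / 2 * u]. The choice [u = T - u * T] gives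
   [u <= T - T * u / 2], the smallness condition needed by [simplex_proj_support]. *)
pose u := T / (1 + T).
have u0 : 0 <= u by rewrite divr_ge0 //; lra.
have uT : u + u * T = T by rewrite /u; field; lra.
pose eps := gap / 2 * u.
have Veps t : Vstar M t - Vpi M pi t <= eps.
  have := le_lt_trans (subopt_ge _ t pi_policy) small.
  by rewrite /C2 -/e -/T -/u -mulrA -mulrA ltr_pM2l // mulrA => /ltW.
have [a a0] := exists_Astar_eq0 M _ pistar_opt s.
have beta := Vstar_subpolicy M _ pistar_opt _ s pi_policy.
apply: (simplex_proj_support _ _ _ _ (gap - eps) (opt_actions M s) b
  (pi_policy s) (pi'_step s)) => //.
- by apply: le_trans (ppg_step_size s); rewrite ltW.
- by apply/set0Pn; exists a; rewrite (opt_actionsE _ _ pistar_opt) a0.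
- move=> i j; rewrite (opt_actionsE _ _ pistar_opt) => /eqP Ai jn.
  have Qj := Qpi_le_Qstar M pi s j pi_policy.
  have := gap_le M _ pistar_opt s j jn.
  (* For optimal [i], [Qpi] falls short of [Qstar] by at most [eps]; for suboptimal [j], it is at
     most [Qstar], which lies [gap] below [Vstar]. *)
  suff : Qstar M s i - Qpi M pi s i <= eps by move: Ai; rewrite /Astar; lra.
  rewrite (Qstar_lookahead _ _ pistar_opt) QpiE_lookahead // /lookahead.
  have [t0 t1] := trans_simplex M s i.
  have : \sum_t trans M s i t * (Vstar M t - Vpi M pi t) <= eps.
    rewrite -[leRHS]mul1r -t1 mulr_suml; apply: ler_sum => t _.
    by rewrite ler_wpM2l.
  under eq_bigr do rewrite mulrBr; rewrite sumrB.
  have /andP[g0 g1] := discount_bounded M.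
  have eps0 : 0 <= eps by rewrite mulr_ge0 // divr_ge0 // ltW.
  move=> /(ler_wpM2l g0); have : gamma * eps <= eps by rewrite ler_piMl // ltW.
  lra.
- set B := \sum_(j | _) pi s j in beta *.
  have Bu : 2 * B <= u.
    by rewrite -(ler_pM2r gap0); have := le_trans beta (Veps s); rewrite /eps; lra.
  apply: (le_trans Bu).
  have epsgap : 0 <= gap - eps.
    have : u <= 1 by rewrite /u ler_pdivrMr; lra.
    by rewrite /eps; nra.
  apply: le_trans (ler_wpM2r epsgap (ppg_step_size s)).
  have -> : eta * mumin * (gap - eps) = T - T * u / 2 by rewrite /T /eps /e; ring.
  have : 0 <= u * T by rewrite mulr_ge0 // ltW.
  lra.
Qed.

Lemma ppg_rate_bounds : nontriv_states M != finset.set0 ->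
  [/\ 0 < C2 M mu rho eta, 4 / (eta * mumin) <= C1 (A := A) mu eta &
      0 < C1 (A := A) mu eta].
Proof.
move=> nt; have gap0 := gap_gt0 M _ pistar_opt nt.
have e0 : 0 < eta * mumin by rewrite mulr_gt0.
have T0 : 0 < eta * mumin * gap by rewrite mulr_gt0.
(* With at least one action, [2 + 5 * #|A|] dominates the 4 of the one-step bound. *)
have A1 : 1 <= #|A|%:R :> R.
  have /set0Pn[s _] := nt; have [a _] := exists_Astar_eq0 M _ pistar_opt s.
  by rewrite ler1n; apply/card_gt0P; exists a.
split.
- by rewrite /C2 mulr_gt0 ?divr_gt0 ?mulr_gt0 // addr_gt0.
- by rewrite /C1 ler_pM2r ?invr_gt0 //; lra.
- by rewrite /C1 divr_gt0 //; lra.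
Qed.

(** Nonnegativity of the factor is proved alongside because the induction on [k] multiplies by
    it. *)
Lemma ppg_contraction :
  let r := (1 - gamma) * C2 M mu rho eta /
    ((1 - gamma) * C2 M mu rho eta + C1 (A := A) mu eta) in
  nontriv_states M != finset.set0 ->
  0 <= 1 - (1 - gamma) * ratio^-1 * r /\
  subopt pi' <= (1 - (1 - gamma) * ratio^-1 * r) * subopt pi.
Proof.
set c := (1 - gamma) * C2 M mu rho eta => r nt.
have [C2_gt0 C1_ge C1_gt0] := ppg_rate_bounds nt.
have /andP[g0 g1] := discount_bounded M.
have g1' : 0 < 1 - gamma by rewrite subr_gt0.
have c0 : 0 < c by rewrite mulr_gt0.
have rE : r * (c + C1 (A := A) mu eta) = c by rewrite /r divfK //; lra.
have r0 : 0 <= r by rewrite divr_ge0 //; lra.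
have r1 : r <= 1 by rewrite /r ler_pdivrMr; lra.
have N1 := ratio_ge1; set N := ratio in N1 *.
have N0 : 0 < N by lra.
have Ni0 : 0 < N^-1 by rewrite invr_gt0.
have Ni1 : N^-1 <= 1 by rewrite invf_le1.
have q0 : 0 <= 1 - (1 - gamma) * N^-1 * r.
  rewrite subr_ge0; apply: mulr_ile1 => //; first by rewrite mulr_ge0 // ltW.
  by apply: mulr_ile1 => //; [exact: ltW|exact: ltW|lra].
split=> //; have [small|big] := ltP (subopt pi) (C2 M mu rho eta).
  by rewrite (ppg_terminates nt small) mulr_ge0 // subopt_ge0.
have r01 : 0 <= r <= 1 by rewrite r0.
(* With [lambda = r] one has [r * C1 = (1 - r) * c], and [c <= (1 - gamma) * d] in this case; the
   penalty [r ^+ 2 * C1] then uses up [r - r ^+ 2] of the coefficient [2 * r - r ^+ 2] and leaves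
   [r]. *)
have := ppg_improvement _ r C1_ge r01; rewrite -/N.
set d := subopt pi in big *; set d' := subopt pi'; set C := C1 _ _ in rE *.
move=> imp.
have dc : c <= (1 - gamma) * d by rewrite ler_pM2l.
have rd : 0 <= r * ((1 - r) * ((1 - gamma) * d) - r * C).
  rewrite mulr_ge0 // subr_ge0.
  have -> : r * C = (1 - r) * c by lra.
  by rewrite ler_wpM2l // subr_ge0.
have : r * ((1 - gamma) * d) <= N * (d - d') by lra.
move=> /(ler_wpM2l (ltW Ni0)); rewrite mulKf ?gt_eqF //; lra.
Qed.

End ProjectedPolicyGradient.

Theorem theorem3p3 (R : realType) (S A : finType) (M : mdp R S A)
  (mu rho : S -> R)
  (mu_simplex : simplex mu) (mu_pos : 0 < min_over setT mu)
  (rho_simplex : simplex rho) (rho_pos : 0 < min_over setT rho)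
  (pistar : S -> A -> R) (pistar_opt : is_optimal_policy M pistar)
  (nontriv : nontriv_states M != finset.set0)
  (eta : R) (eta_pos : 0 < eta)
  (pi : nat -> S -> A -> R) (pi0_policy : is_policy (pi 0%N))
  (pi_ppg : is_ppg M mu (fun _ => eta) pi) :
  forall k : nat,
    avg rho (Vstar M) - avg rho (Vpi M (pi k)) <=
    (1 - (1 - discount M) *
         (norm_infty (fun s => visitation M rho pistar s / rho s))^-1 *
         ((1 - discount M) * C2 M mu rho eta /
          ((1 - discount M) * C2 M mu rho eta + C1 (A := A) mu eta))) ^+ k *
    (avg rho (Vstar M) - avg rho (Vpi M (pi 0%N))).
Proof.
have pi_policy k : is_policy (pi k).
  by case: k => // k s; case: (pi_ppg k s).
elim=> [|k IHk]; first by rewrite expr0 mul1r.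
have [q0 dec] := ppg_contraction M mu rho mu_simplex mu_pos rho_simplex rho_pos
  pistar pistar_opt eta (pi k) (pi k.+1) eta_pos (pi_policy k) (pi_ppg k) nontriv.
by apply: le_trans dec _; rewrite exprS -[leRHS]mulrA ler_wpM2l.
Qed.
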